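(* Let $k\ge 1$ and $P\ge 1$ be integers, let $l_1,\dots,l_k$ be nonnegative integers, and let $b>0$, $c>0$ be integers. Let $G_P=C_P(l_1,\dots,l_k)$ be the circulant (multi)graph on $\mathbb{Z}/P\mathbb{Z}$ and let $\tilde S_P(x)$ be the polynomial, both defined in the context. 1) If the graph $G_P$ has a perfect $2$-colouring with parameters $(b,c)$, then $\tilde S_P(1)$ is divisible by $\frac{b+c}{\gcd(b,c)}$. 2) If $P=q^t$ for some prime number $q$ and integer $t>0$, then the graph $G_P$ has a perfect $2$-colouring with parameters $(b,c)$ if and only if $\tilde S_P(1)$ is divisible by $\frac{b+c}{\gcd(b,c)}$.
   Context: Graphs may have loops and multiple edges. $C_\infty(l_1,\dots,l_k)$ is the graph with vertex set $\mathbb{Z}$ in which numbers differing by $l_i$, for some $i$, are joined by an edge; it is $2k$-regular, the neighbours of a vertex $g$, counted with multiplicity, being $g+l_i$ and $g-l_i$ for $i=1,\dots,k$. $C_P(l_1,\dots,l_k)$ is the graph on $P$ vertices obtained from $C_\infty(l_1,\dots,l_k)$ by reducing vertices modulo $P$: its vertex set is $\mathbb{Z}/P\mathbb{Z}$ and the neighbours of $g$, counted with multiplicity, are the $2k$ elements $g+l_i$, $g-l_i$ ($i=1,\dots,k$) modulo $P$. A perfect $2$-colouring with parameters $(b,c)$ of a regular graph is a colouring of its vertices in two colours (black and white) such that each black vertex has exactly $b$ white neighbours and each white vertex has exactly $c$ black neighbours (neighbours counted with multiplicity). $\Phi_n(x)$ denotes the $n$-th cyclotomic polynomial. Put $M=\max(l_1,\dots,l_k)$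 and $$A(x)=x^M\Big(b+c-2k+\sum_{i=1}^k (x^{l_i}+x^{-l_i})\Big)\in\mathbb{Z}[x],$$ $$\tilde S_P(x)=\prod_{n:\; n\mid P,\ \Phi_n(x)\mid A(x),\ n \text{ is a prime power}}\Phi_n(x),$$ where a prime power means $p^j$ with $p$ prime and $j\ge 1$; an empty product is $1$. *)

(* Defs.v *)
From HB Require Import structures.
From mathcomp Require Import all_boot all_order all_algebra all_field.

Set Implicit Arguments.
Unset Strict Implicit.
Unset Printing Implicit Defensive.

Import Order.TTheory GRing.Theory Num.Theory.
Local Open Scope ring_scope.

(* A finite multigraph on V is given by its multiplicity function: [mult g h]
   is the number of times h occurs among the neighbours of g.  In a colouring
   [col : V -> bool], [true] stands for black and [false] for white. *)
Definition perfect_2_colouring (V : finType) (mult : V -> V -> nat)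
    (b c : nat) (col : V -> bool) : Prop :=
  (forall g, col g -> (\sum_(h | ~~ col h) mult g h)%N = b) /\
  (forall g, ~~ col g -> (\sum_(h | col h) mult g h)%N = c).

(* The vertices of C_P(l_1, ..., l_k) are the residues 0, ..., P - 1, i.e. the
   elements of 'I_P ('Z_P would be wrong for P = 1).  Each i contributes g + l_i
   and g - l_i separately, even when they coincide modulo P. *)
Definition circulant (P k : nat) (l : 'I_k -> nat) (g h : 'I_P) : nat :=
  (\sum_(i < k) ((h%:Z == g%:Z + (l i)%:Z %[mod P])%Z
                 + (h%:Z == g%:Z - (l i)%:Z %[mod P])%Z))%N.

Definition max_step (k : nat) (l : 'I_k -> nat) : nat := (\max_(i < k) l i)%N.

(* The factor 'X^M is multiplied out; since l i <= M for all i, the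
   subtraction in the exponent M - l i is exact. *)
Definition polyA (k : nat) (l : 'I_k -> nat) (b c : nat) : {poly int} :=
  let M := max_step l in
  (b%:Z + c%:Z - (2 * k)%:Z) *: 'X^M
  + \sum_(i < k) ('X^(M + l i) + 'X^(M - l i)).

Definition prime_power (n : nat) : bool :=
  has (fun p => n == (p ^ logn p n)%N) (primes n).

Lemma prime_powerP (n : nat) :
  reflect (exists p j : nat, [/\ prime p, (0 < j)%N & n = (p ^ j)%N])
          (prime_power n).
Proof.
apply: (iffP hasP) => [[p pn /eqP En] | [p [j [pp j0 ->]]]].
  exists p, (logn p n); split=> //; last by rewrite logn_gt0.
  by move: pn; rewrite mem_primes => /andP[].
exists p; last by rewrite pfactorK.
by rewrite -logn_gt0 pfactorK.
Qed.

(* Pseudo-divisibility by the monic polynomial 'Phi_n is divisibility in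
   Z[x]. *)
Lemma dvdp_PhiP (n : nat) (p : {poly int}) :
  reflect (exists q : {poly int}, p = q * 'Phi_n) ('Phi_n %| p).
Proof.
have mP := Cyclotomic_monic n.
by apply: (iffP (Pdiv.IdomainMonic.dvdpP mP p)).
Qed.

Definition polyS (P k : nat) (l : 'I_k -> nat) (b c : nat) : {poly int} :=
  \prod_(n <- divisors P | prime_power n && ('Phi_n %| polyA l b c)) 'Phi_n.

(* Main.v *)
Require Import Defs.
From HB Require Import structures.
From mathcomp Require Import all_boot all_order all_algebra all_field zify.

Set Implicit Arguments.
Unset Strict Implicit.
Unset Printing Implicit Defensive.

Import Order.TTheory GRing.Theory Num.Theory.
Local Open Scope ring_scope.

(* Let F be the sum of X^g over the black vertices g.  Being a perfect colouring
   says A F = c X^M U modulo X^P - 1, with U = 1 + X + ... + X^(P-1), that is,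
   U | A F and (b + c) F(1) = c P.

   Since the Phi_n are irreducible, every Phi_n with n | P a prime power and not
   dividing A divides F.  Their product T satisfies T(1) S(1) = P because
   Phi_(p^j)(1) = p, so c S(1) is a multiple of b + c.

   For P = q^t, let J be the set of j < t with Phi_(q^(j+1)) | A, so that
   S(1) = q^#|J|.  Colour g black when the number formed by its base q digits at
   the positions in J is less than N = c q^#|J| / (b + c).  The digits outside J
   being free, F is a multiple of
   Phi_(q^(j+1)) = 1 + X^(q^j) + ... + X^((q-1) q^j) for each j outside J. *)

(** * Divisibility by cyclotomic polynomials *)

Lemma dvdp_sum (R : idomainType) (I : Type) (r : seq I) (P : pred I)
    (F : I -> {poly R}) (d : {poly R}) :
  (forall i, P i -> d %| F i) -> d %| \sum_(i <- r | P i) F i.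
Proof.
move=> dvF; exact: (big_ind (fun q => d %| q) (dvdp0 d) (@dvdp_add R d)).
Qed.

(** Over the rationals ['Phi_n] is the minimal polynomial of [z]. The remainder of [p] modulo
    ['Phi_n] vanishes at [z] if [p] does, but its degree is too small for a nonzero multiple. *)
Lemma dvdp_Cyclotomic_root (n : nat) (z : algC) (p : {poly int}) :
  n.-primitive_root z -> ('Phi_n %| p) = root (map_poly intr p) z.
Proof.
move=> prim_z; have monPhi := Cyclotomic_monic n.
have rootPhi : root (map_poly intr 'Phi_n) z.
  by rewrite (Cintr_Cyclotomic prim_z) root_cyclotomic.
apply/idP/idP=> [/dvdp_PhiP[q ->] | root_p].
  by rewrite rmorphM rootM rootPhi orbT.
pose r := p %% 'Phi_n.
have root_r : root (map_poly intr r) z.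
  have -> : r = p - p %/ 'Phi_n * 'Phi_n.
    by rewrite {1}[p](Pdiv.IdomainMonic.divp_eq monPhi) addrC addKr.
  rewrite rmorphB rmorphM rootE !hornerE (eqP root_p) (eqP rootPhi).
  by rewrite mulr0 subr0.
have [m [Dm _] dv_m] := minCpolyP z.
have size_m : size m = size 'Phi_n.
  rewrite -(size_map_poly (ratr : rat -> algC)) -Dm.
  by rewrite (minCpoly_cyclotomic prim_z) size_cyclotomic size_Cyclotomic.
have dvm : m %| map_poly intr r.
  rewrite -dv_m -map_poly_comp (eq_map_poly (g := intr)) // => i /=.
  by rewrite ratr_int.
have inj_intr : injective (intr : int -> rat) by apply: intr_inj.
have [r0 | r_nz] := eqVneq r 0; first by rewrite /dvdp -/r r0.
have := dvdp_leq _ dvm; rewrite -size_poly_eq0 size_map_inj_poly //.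
rewrite size_poly_eq0 size_m => /(_ r_nz).
by rewrite leqNgt Pdiv.Idomain.ltn_modp monic_neq0.
Qed.

Lemma dvdp_CyclotomicM (n : nat) (p q : {poly int}) : (0 < n)%N ->
  ('Phi_n %| p * q) = ('Phi_n %| p) || ('Phi_n %| q).
Proof.
move=> /C_prim_root_exists[z prim_z].
by rewrite !(dvdp_Cyclotomic_root _ prim_z) rmorphM rootM.
Qed.

Lemma dvdp_Cyclotomic_eq (n m : nat) : (0 < n)%N ->
  'Phi_n %| 'Phi_m -> n = m.
Proof.
move=> n_gt0; have [z prim_z] := C_prim_root_exists n_gt0.
rewrite (dvdp_Cyclotomic_root _ prim_z).
have [-> | m_gt0] := posnP m.
  by rewrite Cyclotomic0 rmorph1 (negPf (root1 z)).
have [w prim_w] := C_prim_root_exists m_gt0.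
rewrite (Cintr_Cyclotomic prim_w) root_cyclotomic // => prim_z'.
apply/eqP; rewrite eqn_dvd (prim_order_dvd prim_z) (prim_order_dvd prim_z').
by rewrite (prim_expr_order prim_z) (prim_expr_order prim_z') eqxx.
Qed.

(** The ['Phi_n] act as distinct primes: by induction the tail product divides [p], and ['Phi_n],
    dividing no factor of that product, divides the cofactor. *)
Lemma prod_Cyclotomic_dvd (s : seq nat) (p : {poly int}) :
    uniq s -> {in s, forall n, (0 < n)%N && ('Phi_n %| p)} ->
  exists q, p = q * \prod_(n <- s) 'Phi_n.
Proof.
elim: s => [|n s IHs] /= => [_ _ | /andP[n_s uniq_s] dv_s].
  by exists p; rewrite big_nil mulr1.
have [|q Dp] := IHs uniq_s.
  by move=> m m_s; apply: dv_s; rewrite inE m_s orbT.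
have /andP[n_gt0] := dv_s n (mem_head _ _).
rewrite Dp dvdp_CyclotomicM // => /orP[/dvdp_PhiP[q' ->]|].
  by exists q'; rewrite big_cons mulrA.
suffices -> : 'Phi_n %| \prod_(m <- s) 'Phi_m = false by [].
apply: contraNF n_s; elim: (s) => [|m s' IHs'].
  rewrite big_nil dvdp1 size_Cyclotomic eqSS => /eqP n0.
  by move: n_gt0; rewrite -totient_gt0 n0.
rewrite big_cons dvdp_CyclotomicM // inE.
case/orP=> [/dvdp_Cyclotomic_eq-> //|/IHs'->].
  by rewrite eqxx.
by rewrite orbT.
Qed.

(** For n = P this is the polynomial U of the overview. *)
Definition unity_sum (n : nat) : {poly int} := \poly_(i < n) 1.

Lemma unity_sumE (n : nat) : unity_sum n = \sum_(i < n) 'X^i.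
Proof.
by rewrite /unity_sum poly_def; apply: eq_bigr => i _; rewrite scale1r.
Qed.

Lemma unity_sumM (n : nat) : 'X^n - 1 = ('X - 1) * unity_sum n.
Proof. by rewrite unity_sumE subrX1. Qed.

Lemma unity_sum_prod (n : nat) : (0 < n)%N ->
  unity_sum n = \prod_(d <- divisors n | d != 1%N) 'Phi_d.
Proof.
move=> n_gt0; have X1_nz : 'X - 1 != 0 :> {poly int} by rewrite polyXsubC_eq0.
apply: (mulfI X1_nz); rewrite -unity_sumM -prod_Cyclotomic //.
rewrite (bigID (pred1 1%N)) /= -big_filter.
rewrite filter_pred1_uniq ?divisors_uniq ?divisor1 // big_seq1; congr (_ * _).
by have := prod_Cyclotomic (ltn0Sn 0); rewrite big_seq1.
Qed.

(** The divisors of q^(j+1) are those of q^j and q^(j+1) itself, so ['Phi_(q ^ j.+1)] is the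
    quotient of X^(q^(j+1)) - 1 by X^(q^j) - 1, a geometric sum in X^(q^j). *)
Lemma Cyclotomic_pfactor (q j : nat) : prime q ->
  'Phi_(q ^ j.+1) = \sum_(i < q) 'X^(i * q ^ j).
Proof.
move=> q_pr; have q_gt0 := prime_gt0 q_pr; have q_gt1 := prime_gt1 q_pr.
have Xn1_nz : 'X^(q ^ j) - 1 != 0 :> {poly int}.
  by rewrite -size_poly_eq0 size_XnsubC ?expn_gt0 ?q_gt0.
have -> : \sum_(i < q) 'X^(i * q ^ j)
    = \sum_(i < q) 'X^(q ^ j) ^+ i :> {poly int}.
  by apply: eq_bigr => i _; rewrite -exprM mulnC.
apply: (mulfI Xn1_nz); rewrite -subrX1 -exprM -expnSr.
rewrite -!prod_Cyclotomic ?expn_gt0 ?q_gt0 // mulrC.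
have -> : 'Phi_(q ^ j.+1) * \prod_(d <- divisors (q ^ j)) 'Phi_d
  = \prod_(d <- (q ^ j.+1)%N :: divisors (q ^ j)) 'Phi_d by rewrite big_cons.
apply/perm_big/uniq_perm; rewrite /= ?divisors_uniq ?andbT //.
  by rewrite -dvdn_divisors ?expn_gt0 ?q_gt0 // dvdn_Pexp2l // ltnn.
move=> d; rewrite inE -!dvdn_divisors ?expn_gt0 ?q_gt0 //.
apply/orP/idP=> [[/eqP-> //|dv_d]|/(dvdn_pfactor _ _ q_pr)[i]].
  by rewrite (dvdn_trans dv_d) // dvdn_exp2l.
rewrite leq_eqVlt => /orP[/eqP-> ->|]; first by left.
by rewrite ltnS => le_ij ->; right; rewrite dvdn_exp2l.
Qed.

Lemma Cyclotomic_pfactor1 (q j : nat) : prime q -> ('Phi_(q ^ j.+1)).[1] = q%:Z.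
Proof.
move=> q_pr; rewrite Cyclotomic_pfactor // horner_sum.
under eq_bigr do rewrite hornerXn expr1n.
by rewrite sumr_const card_ord natz.
Qed.

(** With [C] always true this serves to compute T(1) S(1) = P; with [C] selecting the divisors of A
    it serves to compute S(1) when P = q^t. *)
Lemma big_prime_power_divisors (R : Type) (idx : R) (op : Monoid.com_law idx)
    (n : nat) (C : pred nat) (F : nat -> R) : (0 < n)%N ->
  \big[op/idx]_(d <- divisors n | prime_power d && C d) F d =
  \big[op/idx]_(p <- primes n)
     \big[op/idx]_(0 <= j < logn p n | C (p ^ j.+1)%N) F (p ^ j.+1)%N.
Proof.
move=> n_gt0; rewrite big_mkcondr -big_filter.
have -> : \big[op/idx]_(p <- primes n)
     \big[op/idx]_(0 <= j < logn p n | C (p ^ j.+1)%N) F (p ^ j.+1)%N =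
   \big[op/idx]_(d <- [seq (p ^ j)%N | p <- primes n, j <- iota 1 (logn p n)])
     (if C d then F d else idx).
  rewrite big_allpairs_dep; apply: eq_bigr => p _.
  by rewrite -[1%N]addn0 iotaDl big_map -big_mkcond /index_iota subn0.
apply/perm_big/uniq_perm.
- by rewrite filter_uniq ?divisors_uniq.
- apply: allpairs_uniq_dep; rewrite ?primes_uniq //.
    by move=> p _; apply: iota_uniq.
  move=> _ _ /allpairsPdep[p [i [p_n + ->]]] /allpairsPdep[r [j [r_n + ->]]] /=.
  rewrite !mem_iota !add1n !ltnS => /andP[i_gt0 _] /andP[j_gt0 _] eq_pr.
  move: p_n r_n; rewrite !mem_primes => /and3P[p_pr _ _] /and3P[r_pr _ _].
  (* Both exponents being positive, equal powers share their prime, and then their exponent. *)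
  have eq_p : p = r.
    have : (p %| r ^ j)%N by rewrite -eq_pr dvdn_exp.
    by rewrite Euclid_dvdX // dvdn_prime2 // => /andP[/eqP].
  rewrite -eq_p in eq_pr *; congr Tagged.
  by apply/eqP; rewrite -(eqn_exp2l _ _ (prime_gt1 p_pr)) eq_pr.
move=> d; rewrite mem_filter -dvdn_divisors //.
apply/andP/allpairsPdep=> [[/prime_powerP[p [j [p_pr j_gt0 ->]]] dv_n]|].
  exists p, j; rewrite mem_primes p_pr n_gt0 mem_iota j_gt0 add1n ltnS.
  by rewrite -pfactor_dvdn // dv_n (dvdn_trans _ dv_n) // dvdn_exp.
move=> [p [j [+ + ->]]]; rewrite mem_primes mem_iota add1n ltnS.
move=> /and3P[p_pr _ _] /andP[j_gt0 le_j]; rewrite pfactor_dvdn //.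
by split=> //; apply/prime_powerP; exists p, j.
Qed.

(** Each prime p contributes one factor p for every positive exponent up to its multiplicity in n,
    which rebuilds the factorization of n. *)
Lemma prod_prime_power_Cyclotomic1 (n : nat) : (0 < n)%N ->
  \prod_(d <- divisors n | prime_power d) ('Phi_d).[1] = n%:Z.
Proof.
move=> n_gt0.
have := big_prime_power_divisors *%R xpredT (fun d => ('Phi_d).[1]) n_gt0.
under eq_bigl do rewrite andbT.
move=> ->; rewrite {3}(prod_prime_decomp n_gt0) prime_decompE big_map /=.
rewrite -natz (big_morph _ (natrM _) (erefl 1%:R)) big_seq [RHS]big_seq.
apply: eq_bigr => p; rewrite mem_primes => /andP[p_pr _].
under eq_bigr do rewrite Cyclotomic_pfactor1 //.
by rewrite prodr_const_nat subn0 natrX natz.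
Qed.

(** * Colourings of circulants as polynomials modulo X^P - 1 *)

(** Writing P as [p.+1] gives the index type its addition modulo P, needed for the translates of [f]
    below. *)
Definition gen_poly (p : nat) (f : 'I_p.+1 -> int) : {poly int} :=
  \sum_(g < p.+1) f g *: 'X^g.

Lemma gen_polyE (p : nat) (f : 'I_p.+1 -> int) :
  gen_poly f = \poly_(i < p.+1) f (inord i).
Proof. by rewrite poly_def; apply: eq_bigr => g _; rewrite inord_val. Qed.

Lemma gen_poly_cst (p : nat) (a : int) :
  gen_poly (fun _ : 'I_p.+1 => a) = a *: unity_sum p.+1.
Proof. by rewrite unity_sumE scaler_sumr. Qed.

Lemma gen_poly_inj (p : nat) (f f' : 'I_p.+1 -> int) :
  gen_poly f = gen_poly f' -> f =1 f'.
Proof.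
rewrite !gen_polyE => eq_ff' g.
have := congr1 (fun q : {poly int} => q`_g) eq_ff'.
by rewrite !coef_poly ltn_ord inord_val.
Qed.

Lemma dvdp_Xn1_expB (n m : nat) : ('X^n - 1 : {poly int}) %| 'X^m - 'X^(m %% n).
Proof.
rewrite {1}(divn_eq m n) exprD -[X in _ %| _ - X]mul1r -mulrBl dvdp_mulr //.
by rewrite mulnC exprM [X in _ %| X]subrX1 dvdp_mulIl.
Qed.

(** After reindexing by g + m, the two sums differ only by the reduction of each exponent modulo p +
    1. *)
Lemma dvdp_gen_poly_shift (p m : nat) (f : 'I_p.+1 -> int) :
  'X^(p.+1) - 1 %| 'X^m * gen_poly f - gen_poly (fun g => f (g - inZp m)).
Proof.
rewrite {2}/gen_poly (reindex_inj (addIr (inZp m))) /= mulr_sumr -sumrB.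
apply: dvdp_sum => g _.
rewrite addrK -scalerAr -scalerBr -exprD -mul_polyC dvdp_mull //.
by rewrite addnC /= modnDmr dvdp_Xn1_expB.
Qed.

(** The adjacency operator of the circulant graph, applied to [f]. *)
Definition neighbour_sum (p k : nat) (l : 'I_k -> nat) (f : 'I_p.+1 -> int) g :=
  \sum_(i < k) (f (g + inZp (l i)) + f (g - inZp (l i))).

(** Modulo X^P - 1 the variable X is invertible, and A / X^M acts on coefficients as b + c - 2k plus
    the adjacency operator. Keeping X^M on the other side avoids negative exponents. *)
Lemma dvdp_polyA_gen_poly (p k : nat) (l : 'I_k -> nat) (b c : nat)
    (f : 'I_p.+1 -> int) :
  'X^(p.+1) - 1 %| polyA l b c * gen_poly f
    - 'X^(max_step l) * gen_poly (fun g => (b%:Z + c%:Z - (2 * k)%:Z) * f g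
                                           + neighbour_sum l f g).
Proof.
set e := b%:Z + c%:Z - _; set M := max_step l.
have le_M i : (l i <= M)%N by rewrite /M /max_step (bigD1 i) //= leq_maxl.
have -> : gen_poly (fun g => e * f g + neighbour_sum l f g) = e *: gen_poly f
  + \sum_(i < k) (gen_poly (fun g => f (g + inZp (l i)))
                  + gen_poly (fun g => f (g - inZp (l i)))).
  rewrite scaler_sumr; under [X in _ = _ + X]eq_bigr do rewrite -big_split.
  rewrite exchange_big -big_split; apply: eq_bigr => g _ /=.
  rewrite scalerDl scalerA scaler_suml; congr (_ + _).
  by apply: eq_bigr => i _; rewrite scalerDl.
rewrite /polyA -/M -/e mulrDl mulrDr -scalerAl -scalerAr.
rewrite opprD addrACA subrr add0r.
rewrite mulr_suml mulr_sumr -sumrB.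
apply: dvdp_sum => i _.
(* X^(M + l i) pairs with the translate f (g - l i), and X^(M - l i) with f (g + l i), hence the
   swap. *)
rewrite mulrDl (addrC (gen_poly _)) mulrDr opprD addrACA dvdp_add //.
  by rewrite exprD -mulrA -mulrBr dvdp_mull // dvdp_gen_poly_shift.
(* For the lowered exponent, [f] is seen as a forward shift by [l i] of its translate f (g + l
   i). *)
have -> : gen_poly f = gen_poly (fun g => f (g - inZp (l i) + inZp (l i))).
  by apply: eq_bigr => g _; rewrite subrK.
have -> : 'X^M = 'X^(M - l i) * 'X^(l i) :> {poly int} by rewrite -exprD subnK.
rewrite -mulrA -mulrBr dvdp_mull // -dvdpNr opprB.
exact: (dvdp_gen_poly_shift (l i) (fun g => f (g + inZp (l i)))).
Qed.

Lemma eqz_mod_addZp (p m : nat) (g h : 'I_p.+1) :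
  (h%:Z == g%:Z + m%:Z %[mod p.+1])%Z = (h == g + inZp m).
Proof.
rewrite -PoszD !modz_nat eqz_nat modn_small ?ltn_ord // -val_eqE /=.
by rewrite modnDmr.
Qed.

Lemma eqz_mod_subZp (p m : nat) (g h : 'I_p.+1) :
  (h%:Z == g%:Z - m%:Z %[mod p.+1])%Z = (h == g - inZp m).
Proof.
rewrite -(eqz_modDr m%:Z) subrK eq_sym eqz_mod_addZp.
by rewrite [RHS]eq_sym subr_eq.
Qed.

Lemma circulant_sum (p k : nat) (l : 'I_k -> nat) (col : pred 'I_p.+1) g :
  (\sum_(h | col h) circulant l g h)%N%:Z
    = neighbour_sum l (fun h => (col h : nat)%:Z) g.
Proof.
rewrite -natz natr_sum; under eq_bigr do rewrite natr_sum.
rewrite exchange_big; apply: eq_bigr => i _ /=.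
under eq_bigr do rewrite eqz_mod_addZp eqz_mod_subZp natrD !natz.
rewrite big_split /= ![\sum_(j | col j) _]big_mkcond /=.
have sum_eq (u : 'I_p.+1) :
    \sum_h (if col h then (h == u : nat)%:Z else 0) = (col u : nat)%:Z.
  rewrite (bigD1 u) //= eqxx big1 ?addr0 => [|h /negPf->]; first by case: col.
  by case: col.
by rewrite !sum_eq.
Qed.

Lemma neighbour_sumC (p k : nat) (l : 'I_k -> nat) (col : pred 'I_p.+1) g :
  neighbour_sum l (fun h => (~~ col h : nat)%:Z) g
    = (2 * k)%:Z - neighbour_sum l (fun h => (col h : nat)%:Z) g.
Proof.
have -> : (2 * k)%:Z = \sum_(i < k) 2%:Z.
  by rewrite sumr_const card_ord -mulr_natr natz -PoszM.
rewrite /neighbour_sum -sumrB; apply: eq_bigr => i _.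
by case: (col (g + _)); case: (col (g - _)).
Qed.

(** One equation covers both colours: at a white vertex it counts c black neighbours; at a black
    one, 2k-regularity turns it into a count of b white neighbours. *)
Lemma perfect_circulantP (p k : nat) (l : 'I_k -> nat) (b c : nat)
    (col : 'I_p.+1 -> bool) :
  perfect_2_colouring (circulant (P := p.+1) l) b c col <->
  forall g, (b%:Z + c%:Z - (2 * k)%:Z) * (col g : nat)%:Z
            + neighbour_sum l (fun h => (col h : nat)%:Z) g = c%:Z.
Proof.
have sumT g := circulant_sum l col g.
have sumF g : (\sum_(h | ~~ col h) circulant l g h)%N%:Z
    = (2 * k)%:Z - neighbour_sum l (fun h => (col h : nat)%:Z) g.
  by rewrite -neighbour_sumC -(circulant_sum l (fun h => ~~ col h)).
split=> [[colT colF] g | col_eq].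
  have := sumF g; have := sumT g.
  by have [gT | gF] := boolP (col g); [rewrite colT | rewrite colF]; lia.
split=> g gP; have := col_eq g; have := sumF g; have := sumT g; move: gP.
  by case: (col g) => // _; lia.
by case: (col g) => // _; lia.
Qed.

Lemma polyA1 (k : nat) (l : 'I_k -> nat) (b c : nat) :
  (polyA l b c).[1] = b%:Z + c%:Z.
Proof.
rewrite /polyA !hornerE horner_sum expr1n.
under eq_bigr do rewrite !hornerE !expr1n.
by rewrite sumr_const card_ord -mulr_natr natz; lia.
Qed.

Lemma unity_sum1 (n : nat) : (unity_sum n).[1] = n%:Z.
Proof.
rewrite unity_sumE horner_sum; under eq_bigr do rewrite hornerXn expr1n.
by rewrite sumr_const card_ord natz.
Qed.

Lemma unity_sum_monic (n : nat) : unity_sum n.+1 \is monic.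
Proof. by rewrite monicE lead_coef_poly. Qed.

(** The colouring is perfect when the function [W] below is constantly c. Divisibility by U says
    that [W] is constant, and the value at 1 then fixes the constant. *)
Lemma perfect_circulant_polyP (p k : nat) (l : 'I_k -> nat) (b c : nat)
    (col : 'I_p.+1 -> bool) :
  perfect_2_colouring (circulant (P := p.+1) l) b c col <->
  unity_sum p.+1 %| polyA l b c * gen_poly (fun g => (col g : nat)%:Z) /\
  (b%:Z + c%:Z) * (gen_poly (fun g => (col g : nat)%:Z)).[1] = (c * p.+1)%:Z.
Proof.
rewrite perfect_circulantP; set F := gen_poly _.
have := dvdp_polyA_gen_poly l b c (fun g => (col g : nat)%:Z).
set W := (fun g => _ + _); rewrite -/F => dvD.
(* Evaluation at 1, a root of X^P - 1. *)
have eq1 : (b%:Z + c%:Z) * F.[1] = (gen_poly W).[1].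
  have : 'X - 1%:P %| polyA l b c * F - 'X^(max_step l) * gen_poly W.
    by apply: dvdp_trans dvD; rewrite unity_sumM dvdp_mulIl.
  rewrite dvdp_XsubCl rootE hornerD hornerN !hornerM hornerXn polyA1.
  by rewrite expr1n mul1r subr_eq0; move/eqP.
have dvU : (unity_sum p.+1 %| polyA l b c * F) = (unity_sum p.+1 %| gen_poly W).
  have coUX : coprimep (unity_sum p.+1) 'X^(max_step l).
    rewrite coprimep_expr // -['X]subr0 -polyC0 coprimep_XsubC rootE.
    by rewrite horner_coef0 coef_poly.
  rewrite -[RHS](Gauss_dvdpr _ coUX).
  rewrite -[X in _ %| X](subrK ('X^(max_step l) * gen_poly W)).
  by rewrite dvdp_addr // (dvdp_trans _ dvD) // unity_sumM dvdp_mulIr.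
(* The polynomial of [W] has degree at most p, the degree of U, so its quotient by U is a
   constant. *)
have {}dvU : unity_sum p.+1 %| polyA l b c * F <->
    exists q, gen_poly W = gen_poly (fun _ : 'I_p.+1 => q).
  rewrite dvU; split=> [|[q ->]];
    last by rewrite gen_poly_cst -mul_polyC dvdp_mulIr.
  move=> /(Pdiv.IdomainMonic.dvdpP (unity_sum_monic p))[q Dq].
  exists q`_0; rewrite gen_poly_cst -mul_polyC -size1_polyC //.
  have [-> | q_nz] := eqVneq q 0; first by rewrite size_poly0.
  have : (size (gen_poly W) <= p.+1)%N by rewrite gen_polyE size_poly.
  rewrite Dq size_Mmonic ?unity_sum_monic // size_poly_eq ?oner_neq0 //.
  by rewrite addnS /= -[X in (_ <= X)%N]add1n leq_add2r.
rewrite dvU eq1; split=> [W_c | [[q eqW]]].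
  have -> : gen_poly W = gen_poly (fun _ : 'I_p.+1 => c%:Z).
    by apply: eq_bigr => g _; rewrite /W W_c.
  by split; [exists c%:Z | rewrite gen_poly_cst hornerZ unity_sum1].
rewrite eqW gen_poly_cst hornerZ unity_sum1 PoszM => /(mulIf _)-eq_qc g.
by have := gen_poly_inj eqW g; rewrite /W => ->; apply: eq_qc.
Qed.

(** * The value of S at 1 and the necessity of the divisibility *)

Lemma polyS1 (P k : nat) (l : 'I_k -> nat) (b c : nat) :
  (polyS P l b c).[1]
    = \prod_(n <- divisors P | prime_power n && ('Phi_n %| polyA l b c))
        ('Phi_n).[1].
Proof. by rewrite horner_prod. Qed.

(** Since gcd (b + c, c) = gcd (b, c), dividing b + c and c by it leaves coprime numbers. *)
Lemma dvdn_addl_div_gcd (b c s : nat) : (0 < c)%N ->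
  (b + c %| c * s)%N -> ((b + c) %/ gcdn b c %| s)%N.
Proof.
move=> c_gt0; have g_gt0 : (0 < gcdn b c)%N by rewrite gcdn_gt0 c_gt0 orbT.
have [dv_bc dv_c] : (gcdn b c %| b + c)%N /\ (gcdn b c %| c)%N.
  by rewrite dvdn_add ?dvdn_gcdl ?dvdn_gcdr.
have Dbc := divnK dv_bc; have Dc := divnK dv_c.
set d := (_ %/ _)%N in Dbc *; set c' := (_ %/ _)%N in Dc.
have co_dc : coprime d c'.
  rewrite /coprime -(eqn_pmul2r g_gt0) muln_gcdl Dbc Dc.
  by rewrite gcdnC gcdnDr gcdnC mul1n.
by rewrite -Dbc -{2}Dc mulnAC dvdn_pmul2r // Gauss_dvdr.
Qed.

Lemma perfect_circulant_dvd (p k : nat) (l : 'I_k -> nat) (b c : nat)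
    (col : 'I_p.+1 -> bool) : (0 < c)%N ->
  perfect_2_colouring (circulant (P := p.+1) l) b c col ->
  (((b + c) %/ gcdn b c)%N%:Z %| (polyS p.+1 l b c).[1])%Z.
Proof.
move=> c_gt0 /perfect_circulant_polyP[]; set F := gen_poly _ => dvU eqF1.
pose J n := 'Phi_n %| polyA l b c.
have [||G DF] := @prod_Cyclotomic_dvd
    [seq n <- divisors p.+1 | prime_power n && ~~ J n] F.
- by rewrite filter_uniq ?divisors_uniq.
- move=> n; rewrite mem_filter -andbA => /and3P[n_pp nJ n_dv].
  have n_gt1 : (1 < n)%N.
    have /prime_powerP[q [j [q_pr j_gt0 ->]]] := n_pp.
    by rewrite -(exp1n j) ltn_exp2r // prime_gt1.
  (* As ['Phi_n] acts as a prime and does not divide A, it is enough that it divides A F; it divides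
     U because n is not 1. *)
  rewrite (ltnW n_gt1) -[_ %| _]orFb -(negPf nJ).
  rewrite -dvdp_CyclotomicM ?(ltnW n_gt1) //.
  apply: dvdp_trans dvU; rewrite unity_sum_prod // (big_rem n) //=.
  by rewrite (gtn_eqF n_gt1) dvdp_mulIl.
have := prod_prime_power_Cyclotomic1 (ltn0Sn p); rewrite (bigID J) /= -polyS1.
move: eqF1; rewrite DF hornerM big_filter horner_prod.
set T1 := \prod_(_ <- _ | _) _; set S1 := (polyS _ _ _ _).[1] => eqF1 ST.
have T1_nz : T1 != 0 by apply/eqP=> T0; move: ST; rewrite T0 mulr0.
(* T(1) is cancelled from (b + c) G(1) T(1) = c P = c S(1) T(1), where F = G T. *)
have eqS : (b%:Z + c%:Z) * G.[1] = c%:Z * S1.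
  by apply: (mulIf T1_nz); rewrite -!mulrA ST eqF1 PoszM.
rewrite dvdzE /= dvdn_addl_div_gcd // -[c]/(`|c%:Z|%N) -abszM -eqS.
by rewrite abszM dvdn_mulr.
Qed.

(** * Colourings for prime power order *)

Section Digits.

Variables (q : nat) (J : pred nat).
Hypothesis q_pr : prime q.

Let q_gt0 : (0 < q)%N := prime_gt0 q_pr.

Definition num_digits (t : nat) : nat := count J (iota 0 t).

Lemma num_digitsS (t : nat) : num_digits t.+1 = (num_digits t + J t)%N.
Proof. by rewrite /num_digits -[t.+1]addn1 iotaD count_cat /= addn0. Qed.

(* The number whose base q digits are those of g at the positions in J, taken
   among the t lowest ones. *)
Fixpoint select_digits (t g : nat) : nat :=
  if t is t'.+1 then
    ((if J t' then g %/ q ^ t' * q ^ num_digits t' else 0)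
     + select_digits t' (g %% q ^ t'))%N
  else 0%N.

(** The F of the overview. The threshold [N] stays arbitrary because removing the leading digit
    changes it. *)
Definition digit_poly (t N : nat) : {poly int} :=
  \sum_(0 <= g < q ^ t) (select_digits t g < N : nat)%:Z *: 'X^g.

(** The sum is split by the leading digit i. At a position in J this digit uses up i q^s of the
    threshold, with s = [num_digits t]; truncated subtraction leaves 0 when no vertex can be black.
    Elsewhere the digit is free. *)
Lemma digit_polyS (t N : nat) :
  digit_poly t.+1 N = \sum_(0 <= i < q) 'X^(i * q ^ t)
    * digit_poly t (if J t then N - i * q ^ num_digits t else N)%N.
Proof.
rewrite /digit_poly expnS big_nat_mul; apply: eq_bigr => i _.
rewrite -{1}[(i * q ^ t)%N]add0n mulSn big_addn addnK mulr_sumr.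
rewrite !big_nat; apply: eq_bigr => g lt_g /=.
rewrite [(g + _)%N]addnC modnMDl modn_small //.
rewrite divnMDl ?expn_gt0 ?q_gt0 // divn_small // addn0.
rewrite -scalerAr -exprD; congr (Posz (nat_of_bool _) *: _).
by case: (J t); rewrite ?add0n ?ltn_subRL.
Qed.

(** Of n consecutive blocks of length m, block i holds [minn (N - i * m) m] of the numbers below
    N. *)
Lemma sum_minn (N m n : nat) :
  (\sum_(0 <= i < n) minn (N - i * m) m = minn N (n * m))%N.
Proof.
elim: n => [|n IHn]; first by rewrite big_nil mul0n minn0.
by rewrite big_nat_recr //= IHn mulSn; lia.
Qed.

(** With s = [num_digits t], each of the q^s selected numbers arises from q^(t - s) values of g;
    multiplying by q^s avoids the quotient. *)
Lemma digit_poly1 (t N : nat) :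
  (digit_poly t N).[1] * (q ^ num_digits t)%N%:Z
    = (minn N (q ^ num_digits t) * q ^ t)%N%:Z.
Proof.
elim: t N => [|t IHt] N.
  rewrite /digit_poly big_nat1 !hornerE /num_digits /= !expn0.
  by case: N => [|[]].
rewrite digit_polyS horner_sum num_digitsS.
under eq_bigr do rewrite hornerM hornerXn expr1n mul1r.
case: (J t) => /=; last first.
  rewrite addn0 sumr_const_nat subn0 mulrnAl IHt expnS.
  by rewrite -mulr_natl natz -PoszM mulnCA.
rewrite addn1 !expnS -[in RHS]sum_minn PoszM mulrCA mulr_suml.
rewrite (eq_bigr _ (fun i _ => IHt (N - i * q ^ num_digits t)%N)).
rewrite mulnCA [in RHS]PoszM; congr (_ * _).
by rewrite big_distrl /= -natz natr_sum; apply: eq_bigr => i _; rewrite natz.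
Qed.

(** When i is the leading position, its free digit contributes exactly the factor 1 + X^(q^i) + ...
    + X^((q-1) q^i); adding higher digits preserves divisibility. *)
Lemma dvdp_digit_poly (t N i : nat) : (i < t)%N -> ~~ J i ->
  'Phi_(q ^ i.+1) %| digit_poly t N.
Proof.
move=> + nJi; elim: t N => // t IHt N; rewrite ltnS leq_eqVlt digit_polyS.
case/orP=> [/eqP <- | lt_it]; last first.
  by apply: dvdp_sum => j _; rewrite dvdp_mull ?IHt.
by rewrite (negPf nJi) -mulr_suml big_mkord -Cyclotomic_pfactor // dvdp_mulIl.
Qed.

End Digits.

Lemma polyS_pfactor1 (q t k : nat) (l : 'I_k -> nat) (b c : nat) :
    prime q -> (0 < t)%N ->
  (polyS (q ^ t) l b c).[1]
    = (q ^ num_digits (fun i => 'Phi_(q ^ i.+1) %| polyA l b c)%R t)%N%:Z.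
Proof.
move=> q_pr t_gt0; pose J n := 'Phi_n %| polyA l b c.
rewrite polyS1 (big_prime_power_divisors _ J) ?expn_gt0 ?prime_gt0 //.
rewrite primesX // primes_prime // big_seq1 pfactorK //.
under eq_bigr do rewrite Cyclotomic_pfactor1 //.
by rewrite big_const_seq iter_mulr_1 /index_iota subn0 -[in RHS]natz natrX natz.
Qed.

Lemma dvd_perfect_circulant (q t p k : nat) (l : 'I_k -> nat) (b c : nat) :
    prime q -> (0 < t)%N -> (0 < c)%N -> p.+1 = (q ^ t)%N ->
    (((b + c) %/ gcdn b c)%N%:Z %| (polyS p.+1 l b c).[1])%Z ->
  exists col : 'I_p.+1 -> bool,
    perfect_2_colouring (circulant (P := p.+1) l) b c col.
Proof.
move=> q_pr t_gt0 c_gt0 Dp; rewrite [X in polyS X]Dp polyS_pfactor1 //.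
set J := fun i => _; set s := num_digits J t; set d := (_ %/ _)%N.
rewrite dvdzE /= => dv_d; set g := gcdn b c in d dv_d.
have g_gt0 : (0 < g)%N by rewrite gcdn_gt0 c_gt0 orbT.
have [dv_bc dv_c] : (g %| b + c)%N /\ (g %| c)%N.
  by rewrite dvdn_add ?dvdn_gcdl ?dvdn_gcdr.
have qs_gt0 : (0 < q ^ s)%N by rewrite expn_gt0 prime_gt0.
(* The solution of (b + c) N = c q^s, an integer because d = (b + c) / g divides q^s. *)
pose N := (c %/ g * (q ^ s %/ d))%N.
have eqN : ((b + c) * N = c * q ^ s)%N.
  rewrite -[in LHS](divnK dv_bc) -[in RHS](divnK dv_c) -[in RHS](divnK dv_d) /N.
  by rewrite -/d mulnC (mulnC d) mulnACA.
have le_N : (N <= q ^ s)%N.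
  by rewrite -(leq_pmul2l c_gt0) -eqN leq_mul2r leq_addl orbT.
exists (fun h => select_digits q J t h < N)%N; apply/perfect_circulant_polyP.
set F := gen_poly _.
have DF : F = digit_poly q J t N by rewrite /digit_poly -Dp big_mkord.
split; last first.
  have qs_nz : (q ^ s)%N%:Z != 0 by rewrite -lt0n.
  apply: (mulIf qs_nz); rewrite -mulrA DF digit_poly1 // (minn_idPl le_N).
  by rewrite -PoszD -!PoszM mulnA eqN Dp mulnAC.
(* U is the product of the ['Phi_n] with n = q^(i+1) and i < t: such a factor divides A if i is in
   J, and F otherwise. *)
have [||Q ->] := @prod_Cyclotomic_dvd
    [seq n <- divisors p.+1 | n != 1%N] (polyA l b c * F).
- by rewrite filter_uniq ?divisors_uniq.
- move=> n; rewrite mem_filter -dvdn_divisors // Dp => /andP[n_neq1].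
  case/(dvdn_pfactor _ _ q_pr)=> -[|i] lt_it Dn; first by rewrite Dn in n_neq1.
  rewrite Dn expn_gt0 prime_gt0 //=.
  have [Ji | nJi] := boolP (J i); first by rewrite dvdp_mulr.
  by rewrite dvdp_mull // DF dvdp_digit_poly.
by rewrite big_filter unity_sum_prod // dvdp_mulIr.
Qed.

Theorem theorem1 (k P : nat) (l : 'I_k -> nat) (b c : nat)
    (hk : (1 <= k)%N) (hP : (1 <= P)%N) (hb : (0 < b)%N) (hc : (0 < c)%N) :
  ((exists col : 'I_P -> bool, perfect_2_colouring (circulant (P := P) l) b c col) ->
     (((b + c) %/ gcdn b c)%N%:Z %| (polyS P l b c).[1])%Z) /\
  (forall q t : nat, prime q -> (0 < t)%N -> P = (q ^ t)%N ->
     ((exists col : 'I_P -> bool, perfect_2_colouring (circulant (P := P) l) b c col) <->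
      (((b + c) %/ gcdn b c)%N%:Z %| (polyS P l b c).[1])%Z)).
Proof.
case: P hP => // p _.
have necessary :
    (exists col, perfect_2_colouring (circulant (P := p.+1) l) b c col) ->
    (((b + c) %/ gcdn b c)%N%:Z %| (polyS p.+1 l b c).[1])%Z.
  by case=> col; apply: perfect_circulant_dvd.
split=> // q t q_pr t_gt0 Dp; split=> //; exact: dvd_perfect_circulant Dp.
Qed.
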